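(* Let $k\ge 1$ and let $f\colon \mathbb{F}_2^k\to\mathbb{F}_2$ be a Boolean function. Then $f$ is a potential $(k,n)$-lifting for all $n\geq k$ if and only if $f$ is an almost lifting. Moreover, if $f$ is an almost lifting, then $\ell(f)\leq 2^{k-1}$.
   Context: A Boolean function $f\colon\mathbb{F}_2^k\to\mathbb{F}_2$ has diameter $k$ if its values depend on both $x_1$ and $x_k$ (a function depends on $x_i$ if changing the $i$-th input bit changes the value for at least one input). For $m\geq k$ let $F_{(m)}\colon\mathbb{F}_2^m\to\mathbb{F}_2^{m-k+1}$ be the induced map without wrap-around, $$F_{(m)}(x_1,\dotsc,x_m)=\big(f(x_1,\dotsc,x_k),f(x_2,\dotsc,x_{k+1}),\dotsc,f(x_{m-k+1},\dotsc,x_m)\big).$$ $F_{(m)}$ is balanced if $|F_{(m)}^{-1}(y)|=2^{k-1}$ for all $y\in\mathbb{F}_2^{m-k+1}$. For $n\ge k$, $f$ is a potential $(k,n)$-lifting if $f$ has diameter $k$ and $F_{(m)}$ is balanced for every $m$ with $k\leq m\leq n$. For $n\geq k$ let $F\colon\mathbb{F}_2^n\to\mathbb{F}_2^n$ be the induced shift-invariant map $$F(x_1,\dotsc,x_n)=\big(f(x_1,x_2,\dotsc,x_k),f(x_2,x_3,\dotsc,x_{k+1}),\dotsc,f(x_n,x_1,\dotsc,x_{k-1})\big)$$ (indices cyclic modulo $n$). Set $\ell_n(f)=\max_{y\in\mathbb{F}_2^n}|F^{-1}(y)|$ and $\ell(f)=\sup_{n\geq k}\ell_n(f)$. The function $f$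 is an almost lifting if $f$ has diameter $k$ and $\ell(f)<\infty$. *)

(* Defs.v *)
From HB Require Import structures.
From mathcomp Require Import all_boot all_order all_algebra.
From mathcomp Require Import boolp classical_sets reals constructive_ereal ereal.

Set Implicit Arguments.
Unset Strict Implicit.
Unset Printing Implicit Defensive.

Import Order.TTheory GRing.Theory Num.Theory.
Local Open Scope ring_scope.

(* Vectors of F_2^n are row vectors; coordinates are numbered from 0, so the
   coordinate x_i is [x 0 (i - 1)]. *)

Definition depends_on k (f : 'rV['F_2]_k -> 'F_2) (i : 'I_k) : Prop :=
  exists x : 'rV['F_2]_k, f (x + delta_mx 0 i) <> f x.

(* Dependence on both x_1 and x_k; meant for k >= 1 (the two indices coincide
   when k = 1). *)
Definition has_diameter k (f : 'rV['F_2]_k -> 'F_2) : Prop :=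
  forall i : 'I_k, i = 0%N :> nat \/ i = k.-1 :> nat -> depends_on f i.

Lemma window_index_subproof k m (km : (k <= m)%N)
  (i : 'I_(m - k).+1) (j : 'I_k) : (i + j < m)%N.
Proof.
have : (i + j.+1 <= (m - k) + k)%N by rewrite leq_add // -ltnS.
by rewrite addnS subnK.
Qed.

Definition window_index k m (km : (k <= m)%N)
  (i : 'I_(m - k).+1) (j : 'I_k) : 'I_m :=
  Ordinal (window_index_subproof km i j).

Definition induced_map k (f : 'rV['F_2]_k -> 'F_2) m (km : (k <= m)%N)
  (x : 'rV['F_2]_m) : 'rV['F_2]_(m - k).+1 :=
  \row_(i < (m - k).+1) f (\row_(j < k) x 0 (window_index km i j)).

Definition balanced k (f : 'rV['F_2]_k -> 'F_2) m (km : (k <= m)%N) : Prop :=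
  forall y : 'rV['F_2]_(m - k).+1,
    #|[set x : 'rV['F_2]_m | induced_map f km x == y]| = (2 ^ k.-1)%N.

Definition potential_lifting k (f : 'rV['F_2]_k -> 'F_2) (n : nat) : Prop :=
  has_diameter f /\
  forall m (km : (k <= m)%N), (m <= n)%N -> balanced f km.

Definition cyclic_index n (i : 'I_n) (j : nat) : 'I_n :=
  Ordinal (ltn_pmod (i + j) (leq_ltn_trans (leq0n i) (ltn_ord i))).

Definition cyclic_map k (f : 'rV['F_2]_k -> 'F_2) n
  (x : 'rV['F_2]_n) : 'rV['F_2]_n :=
  \row_(i < n) f (\row_(j < k) x 0 (cyclic_index i j)).

Definition ell_n k (f : 'rV['F_2]_k -> 'F_2) (n : nat) : nat :=
  \max_(y : 'rV['F_2]_n) #|[set x : 'rV['F_2]_n | cyclic_map f x == y]|.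

Definition ell (R : realType) k (f : 'rV['F_2]_k -> 'F_2) : \bar R :=
  ereal_sup [set ((ell_n f n)%:R)%:E | n in [set n | (k <= n)%N]]%classic.

Definition almost_lifting (R : realType) k (f : 'rV['F_2]_k -> 'F_2) : Prop :=
  has_diameter f /\ (ell R f < +oo)%E.

(* Main.v *)
(** Let pre(w) be the number of preimages, of length |w| + k - 1, of a word w.
Since f takes exactly one value on each window, pre(0w) + pre(1w) = 2 pre(w) =
pre(w0) + pre(w1).  If pre is bounded, these averaging identities force every
extension of a maximizer, and every extension of a minimizer, to keep the same
value of pre; comparing a minimizer u and a maximizer w through the common
extension uw shows that pre is constant, equal to pre(empty) = 2^(k-1).

If l(f) <= C then pre(w) <= 2^(k-1) C: a preimage x of w, read cyclically, maps
to a cyclic word beginning with w, of which there are only 2^(k-1).  Conversely,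
a cyclic preimage of y is determined by its periodic unrolling of length
n + k - 1, which is a preimage of the word y, so l_n(f) <= 2^(k-1) as soon as
pre is constant. *)

Require Import Defs.
From HB Require Import structures.
From mathcomp Require Import all_boot all_order all_algebra.
From mathcomp Require Import boolp classical_sets reals constructive_ereal ereal.

Local Open Scope ring_scope.

Set Implicit Arguments.
Unset Strict Implicit.
Unset Printing Implicit Defensive.

Import Order.TTheory GRing.Theory Num.Theory.

Lemma F2_cases (a : 'F_2) : a = 0 \/ a = 1.
Proof. by case: a => [[|[|m]] lt_m] //; [left | right]; apply: val_inj. Qed.

Lemma count_eq01 {T : Type} (h : T -> 'F_2) (P : pred T) (s : seq T) :
  (count (fun x => (h x == 0%R) && P x) s +
   count (fun x => (h x == 1%R) && P x) s = count P s)%N.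
Proof.
elim: s => //= x s IHs; rewrite addnACA IHs; congr addn.
by case: (F2_cases (h x)) => -> /=; case: (P x).
Qed.

(** * Bounded weights on words that satisfy both averaging identities *)

Section HarmonicWeights.

Variable pre : seq 'F_2 -> nat.
Hypothesis pre_cons :
  forall w, (pre (0%R :: w) + pre (1%R :: w) = (pre w).*2)%N.
Hypothesis pre_rcons :
  forall w, (pre (rcons w 0%R) + pre (rcons w 1%R) = (pre w).*2)%N.

(** Two values that average to an upper bound of both must equal it. Only letters on the left are
    added here, so that the minimum version can add them on the right. *)
Lemma pre_cat_max (w u : seq 'F_2) :
  (forall v, pre v <= pre w)%N -> pre (u ++ w) = pre w.
Proof.
move=> maxw; elim: u => //= a u IHu.
have := pre_cons (u ++ w); rewrite IHu.
have := maxw (0 :: u ++ w); have := maxw (1 :: u ++ w).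
rewrite -addnn.
case: (F2_cases a) => -> le1 le0 eq; apply/eqP; rewrite eqn_leq ?le0 ?le1 /=.
  by rewrite -(leq_add2r (pre w)) -eq leq_add2l.
by rewrite -(leq_add2l (pre w)) -eq leq_add2r.
Qed.

Lemma pre_cat_min (w u : seq 'F_2) :
  (forall v, pre w <= pre v)%N -> pre (w ++ u) = pre w.
Proof.
move=> minw; elim/last_ind: u => [|u a IHu]; first by rewrite cats0.
rewrite -rcons_cat; have := pre_rcons (w ++ u); rewrite IHu.
have := minw (rcons (w ++ u) 0); have := minw (rcons (w ++ u) 1).
rewrite -addnn.
case: (F2_cases a) => -> le1 le0 eq; apply/eqP; rewrite eqn_leq ?le0 ?le1 ?andbT.
  by rewrite -(leq_add2r (pre w)) -eq leq_add2l.
by rewrite -(leq_add2l (pre w)) -eq leq_add2r.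
Qed.

Lemma pre_const (B : nat) :
  (forall w, pre w <= B)%N -> forall w, pre w = pre [::].
Proof.
move=> leB.
(* The attained values form a nonempty set of naturals bounded by [B], so both extrema are attained;
   [asbool] makes the predicate boolean for [ex_maxnP] and [ex_minnP]. *)
pose Q n := `[< exists w, pre w = n >].
have exQ : exists n, Q n by exists (pre [::]); apply/asboolP; exists [::].
have Q_pre w : Q (pre w) by apply/asboolP; exists w.
have ubQ n : Q n -> (n <= B)%N by move=> /asboolP[w <-].
case: (ex_maxnP exQ ubQ) => M /asboolP[wM eqM] maxM.
case: (ex_minnP exQ) => m /asboolP[wm eqm] minm.
have mM : m = M.
  rewrite -eqm -eqM -(@pre_cat_min wm wM) ?(@pre_cat_max wM wm) // => v.
    by rewrite eqM maxM.
  by rewrite eqm minm.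
have eq_m w : pre w = m.
  by apply/eqP; rewrite eqn_leq minm // mM maxM.
by move=> w; rewrite !eq_m.
Qed.

End HarmonicWeights.

(** * Counting binary words of a given length *)

Definition seq_of_row {n : nat} (x : 'rV['F_2]_n) : seq 'F_2 :=
  [seq x 0 i | i <- enum 'I_n].

Definition words (n : nat) : seq (seq 'F_2) :=
  [seq seq_of_row x | x <- enum {: 'rV['F_2]_n}].

Lemma size_seq_of_row {n : nat} (x : 'rV['F_2]_n) : size (seq_of_row x) = n.
Proof. by rewrite size_map size_enum_ord. Qed.

Lemma nth_seq_of_row {n : nat} (x : 'rV['F_2]_n) (i : 'I_n) :
  nth 0 (seq_of_row x) i = x 0 i.
Proof. by rewrite (nth_map i) ?size_enum_ord ?nth_ord_enum. Qed.

Lemma seq_of_row_inj {n : nat} : injective (@seq_of_row n).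
Proof.
by move=> x y eqxy; apply/rowP => i; rewrite -!nth_seq_of_row eqxy.
Qed.

Lemma words_uniq (n : nat) : uniq (words n).
Proof. by rewrite map_inj_uniq ?enum_uniq //; apply: seq_of_row_inj. Qed.

Lemma mem_words (n : nat) (s : seq 'F_2) : (s \in words n) = (size s == n).
Proof.
apply/mapP/eqP => [[x _ ->]|sz_s]; first exact: size_seq_of_row.
exists (\row_i nth 0 s i); first by rewrite mem_enum.
apply: (@eq_from_nth _ 0); rewrite sz_s ?size_seq_of_row // => i lt_in.
by rewrite (nth_seq_of_row _ (Ordinal lt_in)) mxE.
Qed.

Lemma size_words (n : nat) : size (words n) = (2 ^ n)%N.
Proof. by rewrite size_map -cardE card_mx card_Fp // mul1n. Qed.

Lemma count_words (n : nat) (P : pred (seq 'F_2)) :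
  count P (words n) = #|[set x : 'rV['F_2]_n | P (seq_of_row x)]|.
Proof.
by rewrite cardsE cardE /enum_mem size_filter count_map enumT; apply: eq_count.
Qed.

(** The images of [words n] under [op 0] and [op 1] are disjoint, lie in [words n.+1] and have its
    total size, so together they permute it. The abstract [op] serves both [cons] and [rcons]. *)
Lemma count_wordsS_gen (op : 'F_2 -> seq 'F_2 -> seq 'F_2) (n : nat)
    (P : pred (seq 'F_2)) :
  (forall a b s t, op a s = op b t -> (a, s) = (b, t)) ->
  (forall a s, size (op a s) = (size s).+1) ->
  (count P (words n.+1) = count (P \o op 0%R) (words n) +
                          count (P \o op 1%R) (words n))%N.
Proof.
move=> op_inj size_op.
have op_inj1 a : injective (op a) by move=> s t /op_inj[].
transitivity (count P (map (op 0%R) (words n) ++ map (op 1%R) (words n)));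
  last by rewrite count_cat !count_map.
have Us : uniq (map (op 0) (words n) ++ map (op 1) (words n)).
  rewrite cat_uniq !(map_inj_uniq (op_inj1 _)) !words_uniq andbT /=.
  by apply/hasPn => _ /mapP[s _ ->]; apply/mapP => -[t _ /op_inj[]].
apply/permP; rewrite perm_sym; apply: uniq_perm; rewrite ?words_uniq //.
have sub : {subset map (op 0) (words n) ++ map (op 1) (words n)
              <= words n.+1}.
  move=> s; rewrite mem_cat.
  by case/orP=> /mapP[t]; rewrite !mem_words => /eqP <- ->; rewrite size_op.
apply: (uniq_min_size Us sub _).2.
by rewrite size_cat !(size_map (op _)) !size_words expnS mul2n addnn.
Qed.

Lemma count_words_cons (n : nat) (P : pred (seq 'F_2)) :
  (count P (words n.+1) = count (fun s => P (0%R :: s)) (words n) +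
                          count (fun s => P (1%R :: s)) (words n))%N.
Proof. by apply: (@count_wordsS_gen cons) => // a b s t [-> ->]. Qed.

Lemma count_words_rcons (n : nat) (P : pred (seq 'F_2)) :
  (count P (words n.+1) = count (fun s => P (rcons s 0%R)) (words n) +
                          count (fun s => P (rcons s 1%R)) (words n))%N.
Proof.
apply: (@count_wordsS_gen (fun a s => rcons s a)) => [a b s t|a s].
  by move/rcons_inj=> [-> ->].
by rewrite size_rcons.
Qed.

(** * Preimage counts of words, with k written as [K.+1] *)

Section Preimages.

Variables (K : nat) (f : 'rV['F_2]_K.+1 -> 'F_2).

(* Positions beyond the end of [s] are read as 0. *)
Definition local_rule (s : seq 'F_2) : 'F_2 := f (\row_(j < K.+1) nth 0 s j).

(** The length of [x] is left free; at length [size w + K], as in [preimages], every window read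
    here fits inside [x]. *)
Definition maps_to (w x : seq 'F_2) : bool :=
  all (fun i => local_rule (drop i x) == nth 0 w i) (iota 0 (size w)).

Definition preimages (w : seq 'F_2) : nat :=
  count (maps_to w) (words (size w + K)).

Lemma maps_toP (w x : seq 'F_2) :
  reflect (forall i, (i < size w)%N -> local_rule (drop i x) = nth 0 w i)
          (maps_to w x).
Proof.
apply: (iffP allP) => [sol i lt_i|sol i].
  by apply/eqP/sol; rewrite mem_iota.
by rewrite mem_iota => /= lt_i; apply/eqP/sol.
Qed.

Lemma maps_to_cons (a : 'F_2) (w x : seq 'F_2) :
  maps_to (a :: w) x = (local_rule x == a) && maps_to w (behead x).
Proof.
rewrite /maps_to /= drop0; congr andb.
rewrite (iotaDl 1 0) all_map; apply: eq_all => i /=.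
by rewrite -drop1 drop_drop add1n addn1.
Qed.

Lemma local_rule_cat (x y : seq 'F_2) :
  (K < size x)%N -> local_rule (x ++ y) = local_rule x.
Proof.
move=> ltK; congr f; apply/rowP => j; rewrite !mxE nth_cat.
by rewrite (leq_trans (ltn_ord j)).
Qed.

(** At this length, windows starting before [size w] end inside [x], so [b] enters only the last
    window. *)
Lemma maps_to_rcons (a b : 'F_2) (w x : seq 'F_2) :
  size x = (size w + K)%N ->
  maps_to (rcons w a) (rcons x b) =
    (local_rule (drop (size w) (rcons x b)) == a) && maps_to w x.
Proof.
move=> sz_x; rewrite /maps_to size_rcons -[(size w).+1]addn1 iotaD.
rewrite all_cat /= andbT.
rewrite nth_rcons ltnn eqxx andbC; congr andb; apply: eq_in_all => i.
rewrite mem_iota /= add0n => lt_i; rewrite nth_rcons lt_i drop_rcons.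
  rewrite -cats1 local_rule_cat // size_drop sz_x ltn_subRL.
  by rewrite ltn_add2r.
by rewrite sz_x (leq_trans (ltnW lt_i)) ?leq_addr.
Qed.

(** Summing over the output letter removes the condition on the first window; the first input letter
    is then free, which gives the factor 2. *)
Lemma preimages_cons (w : seq 'F_2) :
  (preimages (0%R :: w) + preimages (1%R :: w) = (preimages w).*2)%N.
Proof.
rewrite /preimages /= addSn.
under eq_count do rewrite maps_to_cons.
under [X in (_ + X)%N]eq_count do rewrite maps_to_cons.
by rewrite count_eq01 count_words_cons addnn.
Qed.

Lemma preimages_rcons (w : seq 'F_2) :
  (preimages (rcons w 0%R) + preimages (rcons w 1%R) = (preimages w).*2)%N.
Proof.
rewrite /preimages !size_rcons addSn !count_words_rcons -addnn addnACA.
(* The four counts are now grouped by the last input letter [b] instead of the output letter. *)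
have step b : (count (fun s => maps_to (rcons w 0%R) (rcons s b))
                 (words (size w + K)) +
               count (fun s => maps_to (rcons w 1%R) (rcons s b))
                 (words (size w + K)) =
               count (maps_to w) (words (size w + K)))%N.
  rewrite -(@count_eq01 _ (fun s => local_rule (drop (size w) (rcons s b)))
    (maps_to w)).
  by congr (_ + _)%N; apply: eq_in_count => s; rewrite mem_words => /eqP sz_s;
    rewrite maps_to_rcons.
by rewrite !step.
Qed.

Lemma preimages_nil : preimages [::] = (2 ^ K)%N.
Proof.
by rewrite /preimages (eq_count (a2 := predT)) // count_predT size_words.
Qed.

Lemma induced_map_eq {m : nat} (km : (K.+1 <= m)%N) (x : 'rV['F_2]_m)
    (y : 'rV['F_2]_(m - K.+1).+1) :
  (induced_map f km x == y) = maps_to (seq_of_row y) (seq_of_row x).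
Proof.
have wE i : induced_map f km x 0 i = local_rule (drop i (seq_of_row x)).
  rewrite mxE; congr f; apply/rowP => j; rewrite !mxE nth_drop.
  by rewrite -nth_seq_of_row.
apply/eqP/maps_toP => [<- i|sol].
  rewrite size_seq_of_row => lt_i.
  by rewrite (nth_seq_of_row _ (Ordinal lt_i)) wE.
by apply/rowP => i; rewrite wE sol ?size_seq_of_row ?nth_seq_of_row.
Qed.

Lemma card_induced_map {m : nat} (km : (K.+1 <= m)%N)
    (y : 'rV['F_2]_(m - K.+1).+1) :
  #|[set x | induced_map f km x == y]| = preimages (seq_of_row y).
Proof.
have szE : (size (seq_of_row y) + K = m)%N.
  by rewrite size_seq_of_row addSnnS subnK.
rewrite /preimages szE count_words; apply: eq_card => x.
by rewrite !inE induced_map_eq.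
Qed.

(** * Comparison of cyclic preimages with preimages of words *)

Definition unroll {n : nat} (x : 'rV['F_2]_n) : seq 'F_2 :=
  mkseq (fun i => nth 0 (seq_of_row x) (i %% n)) (n + K).

Lemma cyclic_map_nth {n : nat} (x : 'rV['F_2]_n) (i : 'I_n) :
  cyclic_map f x 0 i = local_rule (drop i (unroll x)).
Proof.
rewrite mxE; congr f; apply/rowP => j; rewrite !mxE nth_drop nth_mkseq.
  by rewrite -nth_seq_of_row.
by rewrite -addSn leq_add // -ltnS.
Qed.

Lemma unroll_prefix {n : nat} (x : 'rV['F_2]_n) (i : nat) :
  (i < n)%N -> nth 0 (unroll x) i = nth 0 (seq_of_row x) i.
Proof.
by move=> lt_i; rewrite nth_mkseq ?modn_small // (leq_trans lt_i) ?leq_addr.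
Qed.

Lemma unroll_inj {n : nat} : injective (@unroll n).
Proof.
move=> x y eqxy; apply/rowP => i.
by rewrite -!nth_seq_of_row -!unroll_prefix // eqxy.
Qed.

Lemma card_cyclic_map_le {n : nat} (y : 'rV['F_2]_n) :
  (#|[set x | cyclic_map f x == y]| <= preimages (seq_of_row y))%N.
Proof.
rewrite cardE -(size_map unroll) /preimages -size_filter.
apply: uniq_leq_size; first by rewrite (map_inj_uniq unroll_inj) enum_uniq.
move=> _ /mapP[x + ->]; rewrite mem_enum inE => /eqP eqy.
rewrite mem_filter mem_words size_mkseq size_seq_of_row eqxx andbT.
apply/maps_toP => i; rewrite size_seq_of_row => lt_i.
by rewrite (nth_seq_of_row _ (Ordinal lt_i)) -eqy cyclic_map_nth.
Qed.

(** The first [size w] cyclic windows end before position [n], so they do not wrap around. *)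
Lemma maps_to_cyclic {n : nat} (w : seq 'F_2) (x : 'rV['F_2]_n) :
  n = (size w + K)%N -> maps_to w (seq_of_row x) ->
  take (size w) (seq_of_row (cyclic_map f x)) = w.
Proof.
move=> nE /maps_toP sol.
have le_wn : (size w <= n)%N by rewrite nE leq_addr.
apply: (@eq_from_nth _ 0); rewrite size_takel ?size_seq_of_row // => i lt_i.
have lt_in := leq_trans lt_i le_wn.
rewrite nth_take // (nth_seq_of_row _ (Ordinal lt_in)) cyclic_map_nth -sol //.
congr f; apply/rowP => j; rewrite !mxE !nth_drop unroll_prefix //=.
by rewrite nE -addSn leq_add // -ltnS.
Qed.

(** Such a row is determined by its last [K] letters. *)
Lemma card_rows_take {n : nat} (w : seq 'F_2) :
  n = (size w + K)%N ->
  (#|[set y : 'rV['F_2]_n | take (size w) (seq_of_row y) == w]| <= 2 ^ K)%N.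
Proof.
move=> nE; rewrite cardE -(size_map (fun y => drop (size w) (seq_of_row y))).
rewrite -size_words; apply: uniq_leq_size.
  rewrite map_inj_in_uniq ?enum_uniq // => x y.
  rewrite !mem_enum !inE => /eqP eqx /eqP eqy eqxy; apply: seq_of_row_inj.
  by rewrite -[LHS](cat_take_drop (size w)) eqxy eqx -{1}eqy cat_take_drop.
move=> _ /mapP[y _ ->].
by rewrite mem_words size_drop size_seq_of_row nE addKn.
Qed.

Lemma preimages_le (C : nat) :
  (forall n, (K.+1 <= n)%N -> (ell_n f n <= C)%N) ->
  forall w, (preimages w <= 2 ^ K * C.+1)%N.
Proof.
(* The empty word would give n = [K], too short for [ellC]; the successor in [C.+1] covers this case
   even when [C] is 0. *)
move=> ellC [|a w0]; first by rewrite preimages_nil leq_pmulr.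
set w := a :: w0; set n := (size w + K)%N.
pose Y := [set y : 'rV['F_2]_n | take (size w) (seq_of_row y) == w].
rewrite /preimages count_words -/n -sum1_card.
(* Preimages of [w] are sorted by their cyclic image, which lies in [Y]; each class has at most [C]
   elements. *)
rewrite (partition_big (@cyclic_map _ f n) (mem Y)) /=; last first.
  by move=> x; rewrite !inE => /(maps_to_cyclic (erefl n)) ->.
apply: (@leq_trans (\sum_(y in Y) C)).
  apply: leq_sum => y _; rewrite sum1_card.
  apply: leq_trans (ellC n _); last by rewrite /n /= addSn ltnS leq_addl.
  apply: leq_trans (leq_bigmax y); apply: subset_leq_card.
  by apply/fintype.subsetP => x; rewrite !inE => /andP[].
by rewrite sum_nat_const leq_mul // card_rows_take.
Qed.

Lemma bounded_balanced (C : nat) :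
  (forall n, (K.+1 <= n)%N -> (ell_n f n <= C)%N) ->
  forall m (km : (K.+1 <= m)%N), balanced f km.
Proof.
move=> ellC m km y; rewrite card_induced_map -preimages_nil.
exact: pre_const preimages_cons preimages_rcons _ (preimages_le ellC) _.
Qed.

Lemma balanced_ell_n_le (n : nat) (kn : (K.+1 <= n + K)%N) :
  balanced f kn -> (ell_n f n <= 2 ^ K)%N.
Proof.
move=> bal; apply/bigmax_leqP => y _; apply: leq_trans (card_cyclic_map_le y) _.
have nE : ((n + K - K.+1).+1 = n)%N by rewrite -subSn // subSS addnK.
(* The output length for inputs of length [n + K] is only provably equal to [n]; the cast leaves the
   underlying word unchanged. *)
pose y' : 'rV['F_2]_(n + K - K.+1).+1 := castmx (erefl, esym nE) y.
have -> : seq_of_row y = seq_of_row y'.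
  apply: (@eq_from_nth _ 0); rewrite !size_seq_of_row // => i lt_i.
  have lt_i' : (i < (n + K - K.+1).+1)%N by rewrite nE.
  rewrite (nth_seq_of_row y (Ordinal lt_i)) (nth_seq_of_row y' (Ordinal lt_i')).
  by rewrite castmxE; congr (y _ _); apply: val_inj.
by rewrite -(card_induced_map kn) bal.
Qed.

End Preimages.

(** * Passage between the supremum and uniform natural bounds *)

Lemma ell_lt_pinfty (R : realType) {k : nat} (f : 'rV['F_2]_k -> 'F_2) :
  (ell R f < +oo)%E ->
  exists C, forall n, (k <= n)%N -> (ell_n f n <= C)%N.
Proof.
move=> lt_oo.
have ub n : (k <= n)%N -> (((ell_n f n)%:R)%:E <= ell R f)%E.
  by move=> kn; apply: ereal_sup_ubound; exists n.
case E: (ell R f) lt_oo ub => [r| |] // _ ub.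
  exists (Num.bound `|r|) => n /ub; rewrite lee_fin => le_r.
  rewrite -(ler_nat R) (le_trans le_r) // (le_trans (ler_norm r)) // ltW //.
  by rewrite archi_boundP.
(* The term at n = k excludes a supremum equal to minus infinity. *)
by have := ub k (leqnn k); rewrite leeNy_eq.
Qed.

Theorem theorem3p8 (R : realType) (k : nat) (hk : (1 <= k)%N)
    (f : 'rV['F_2]_k -> 'F_2) :
  ((forall n : nat, (k <= n)%N -> potential_lifting f n) <->
     almost_lifting R f) /\
  (almost_lifting R f -> (ell R f <= ((2 ^ k.-1)%N%:R)%:E)%E).
Proof.
case: k hk f => // K _ f.
have almost_potential : almost_lifting R f ->
    forall n : nat, (K.+1 <= n)%N -> potential_lifting f n.
  move=> [diam /ell_lt_pinfty[C ellC]] n _; split=> // m km _.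
  exact: bounded_balanced ellC m km.
have potential_ell : (forall n : nat, (K.+1 <= n)%N -> potential_lifting f n) ->
    (ell R f <= ((2 ^ K)%N%:R)%:E)%E.
  move=> lift; apply: ge_ereal_sup => _ [n /= kn <-].
  (* Unrolled words have length [n + K], so the lifting property is invoked there rather than at
     [n]. *)
  have kn' : (K.+1 <= n + K)%N by rewrite (leq_trans kn) ?leq_addr.
  rewrite lee_fin ler_nat; apply: (@balanced_ell_n_le _ _ _ kn').
  by have [_] := lift _ kn'; apply.
split; last by move/almost_potential/potential_ell.
split=> // lift; split; first by have [] := lift _ (leqnn _).
exact: le_lt_trans (potential_ell lift) (ltry _).
Qed.
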